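(* Let $A\geq a\geq 1$ and $r\geq 2$ be integers. Then \[ \sum_{\pi\in\overline{\mathcal{P}}}z^{\widetilde{mes}_{r,A,a}(\pi)} q^{|\pi|} =\frac{(-q;q)_{\infty }}{(q;q)_{\infty}}\sum_{k=0}^{\infty }z^{kA+a}\bigg[\frac{q^{A\binom{k}{2}+ka}}{(-q^{a};q^{A})_{k}}(-q^{(r-2)a};q^{(r-2)A})_{k}-\frac{q^{A\binom{k+1}{2}+(k+1)a}}{(-q^{a};q^{A})_{k+1}}(-q^{(r-2)a};q^{(r-2)A})_{k+1}\bigg]. \]
   Context: An overpartition is a partition (finite non-increasing sequence of positive integers) in which the first occurrence of each part value may be overlined; $\overline{\mathcal{P}}$ is the set of all overpartitions and $|\pi|$ the sum of parts. $(a;q)_\infty=\prod_{i\geq0}(1-aq^i)$, $(a;q)_n=\prod_{i=0}^{n-1}(1-aq^i)$ (so when $r=2$, $(-q^{0};q^{0})_k=2^k$); $|q|<1$, $z$ a formal variable. For $r\geq2$, $\widetilde{mes}_{r,A,a}(\pi)$ is the smallest positive integer $m\equiv a\pmod A$ such that $\pi$ has no overlined part $\overline{m}$ and $\pi$ has fewer than $r-1$ non-overlined parts equal to $m$. *)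

(* Defs.v *)
From HB Require Import structures.
From mathcomp Require Import all_boot all_order all_algebra.
From mathcomp Require Import boolp classical_sets functions reals topology.
From mathcomp Require Import normedtype sequences.
(* Not imported: its [sum] would hide the sum type. *)
From mathcomp Require summability.

Set Implicit Arguments.
Unset Strict Implicit.
Unset Printing Implicit Defensive.

Import Order.TTheory GRing.Theory Num.Theory.
Import numFieldNormedType.Exports.

Local Open Scope classical_set_scope.
Local Open Scope ring_scope.

(* [(m, true)] is the overlined part m, [(m, false)] the non-overlined one.
   The pairwise condition says that an overlined part differs in value from
   every earlier part, i.e., is the first occurrence of its value. *)
Definition is_overpartition (s : seq (nat * bool)) : bool :=
  [&& all [pred x | (0 < x.1)%N] s,
      sorted geq (unzip1 s)
    & pairwise [rel x y | y.2 ==> (x.1 != y.1)] s].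

Record overpartition := Overpartition {
  op_parts :> seq (nat * bool);
  _ : is_overpartition op_parts }.

HB.instance Definition _ := [isSub for op_parts].
HB.instance Definition _ := [Countable of overpartition by <:].

Definition weight (p : overpartition) : nat := (\sum_(x <- p) x.1)%N.

Definition mes_pred (r A a : nat) (p : overpartition) : pred nat :=
  fun m => [&& (0 < m)%N, m == a %[mod A],
               (m, true) \notin op_parts p
             & (count_mem (m, false) p < r.-1)%N].

(* The default value 0 is never used when 0 < A and 1 < r: see [mes_pred_ex]. *)
Definition mes (r A a : nat) (p : overpartition) : nat :=
  if pselect (exists m, mes_pred r A a p m) is left ex_m then ex_minn ex_m
  else 0%N.

Lemma mes_pred_ex r A a p : (0 < A)%N -> (1 < r)%N ->
  exists m, mes_pred r A a p m.
Proof.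
move=> A_gt0 r_gt1; exists ((weight p).+1 * A + a)%N.
have big b : (((weight p).+1 * A + a)%N, b) \notin op_parts p.
  apply/negP => mp; suff: ((weight p).+1 * A + a <= weight p)%N.
    by apply/negP; rewrite -ltnNge (leq_trans _ (leq_addr _ _)) // leq_pmulr.
  by rewrite [leqRHS]/weight (big_rem _ mp) /= leq_addr.
apply/and4P; split; rewrite ?big //.
- by rewrite addn_gt0 muln_gt0 A_gt0.
- by rewrite modnMDl.
- by rewrite (count_memPn (big false)); case: r r_gt1 => [|[]].
Qed.

Lemma mesP r A a p : (0 < A)%N -> (1 < r)%N ->
  mes_pred r A a p (mes r A a p) /\
  forall m, mes_pred r A a p m -> (mes r A a p <= m)%N.
Proof.
move=> A_gt0 r_gt1; rewrite /mes; case: pselect => [ex_m|[]].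
  by case: ex_minnP.
exact: mes_pred_ex.
Qed.

Section QPochhammer.
Context {K : numFieldType}.
Implicit Types x q : K.

Definition qpoch x q (n : nat) : K := \prod_(i < n) (1 - x * q ^+ i).

Definition qpoch_infty x q : K := lim (qpoch x q n @[n --> \oo]).

End QPochhammer.

(* Formal power series in z over K are represented by their coefficient
   sequences, and families of such series are summed coefficientwise; each
   coefficient is summed unconditionally, i.e., as a limit along the directed
   set of finite subsets of the index type. *)
Section ZSeries.
Context {K : numFieldType}.

Definition zmonom (c : K) (m : nat) : nat -> K :=
  fun n => if n == m then c else 0.

Definition zsummable (I : choiceType) (F : I -> nat -> K) : Prop :=
  forall n, cvg (summability.partial_sum (F ^~ n) @ summability.totally).

Definition zsum (I : choiceType) (F : I -> nat -> K) : nat -> K :=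
  fun n => lim (summability.partial_sum (F ^~ n) @ summability.totally).

Definition zscale (c : K) (f : nat -> K) : nat -> K := fun n => c * f n.

End ZSeries.

(* Main.v *)
(* For an arbitrary set P of overpartitions, let F(P) be the sum of q^|p| over
   p in P. If membership in P does not depend on the parts equal to m, inserting
   a part m shows that the members of P without (with) the overlined part m
   contribute F(P)/(1+q^m) (resp. q^m F(P)/(1+q^m)), and that requiring moreover
   j non-overlined copies of m multiplies the former by q^(jm). Hence demanding
   that m violate the condition defining mes multiplies F(P) by
   q^m (1 + q^((r-2)m)) / (1 + q^m). These factors multiply along
   m = a, A+a, ..., (k-1)A+a, and the coefficient of z^(kA+a) is a difference of
   two consecutive products. In the same way, forbidding the parts equal to m
   multiplies F(P) by (1-q^m)/(1+q^m), so that the overpartitions with parts at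
   most N contribute (-q;q)_N / (q;q)_N; letting N grow gives the prefactor. *)
Require Import Defs.
From HB Require Import structures.
From mathcomp Require Import all_boot all_order all_algebra.
From mathcomp Require Import finmap.
From mathcomp Require Import boolp classical_sets reals topology.
From mathcomp Require Import normedtype sequences.
From mathcomp Require Import complex.
From mathcomp Require Import zify ring lra.
From mathcomp Require summability.

Set Implicit Arguments.
Unset Strict Implicit.
Unset Printing Implicit Defensive.

Import Order.TTheory GRing.Theory Num.Theory.
Import numFieldNormedType.Exports.

Local Open Scope classical_set_scope.
Local Open Scope ring_scope.

#[local] Existing Instance summability.totally_filter.

Section HasSum.
Context {K : numFieldType}.
Implicit Types (I : choiceType) (s t : K).

Definition has_sum I (f : I -> K) s : Prop :=
  summability.partial_sum f @ summability.totally --> s.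

Definition has_sum_on I (P : pred I) (f : I -> K) s : Prop :=
  has_sum (fun i => if P i then f i else 0) s.

Lemma has_sumP I (f : I -> K) s :
  has_sum f s <->
  forall e : K, 0 < e -> exists J0 : {fset I}, forall J : {fset I},
    (J0 `<=` J)%fset -> `|s - \sum_(i <- J) f i| < e.
Proof.
rewrite /has_sum; split=> [/cvgrPdist_lt fs e e_gt0|fs].
  have [J0 _ J0P] := fs e e_gt0; exists J0 => J /J0P /=.
  by rewrite /summability.partial_sum big_seq_fsetE.
apply/cvgrPdist_lt => e /fs[J0 J0P]; exists J0 => // J /J0P /=.
by rewrite /summability.partial_sum big_seq_fsetE.
Qed.

Lemma has_sum_onP I (P : pred I) (f : I -> K) s :
  has_sum_on P f s <->
  forall e : K, 0 < e -> exists J0 : {fset I}, forall J : {fset I},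
    (J0 `<=` J)%fset -> `|s - \sum_(i <- J | P i) f i| < e.
Proof.
rewrite /has_sum_on has_sumP.
split=> fs e /fs[J0 J0P]; exists J0 => J /J0P.
- by rewrite [in X in _ -> X]big_mkcond.
- by rewrite [in X in X -> _]big_mkcond.
Qed.

Lemma has_sum_cvg I (f : I -> K) s :
  has_sum f s -> cvg (summability.partial_sum f @ summability.totally).
Proof. by move=> fs; apply/cvg_ex; exists s. Qed.

Lemma has_sum_lim I (f : I -> K) s :
  has_sum f s -> lim (summability.partial_sum f @ summability.totally) = s.
Proof. by move=> fs; apply: cvg_lim => //; exact: norm_hausdorff. Qed.

Lemma has_sum_unique I (f : I -> K) s t : has_sum f s -> has_sum f t -> s = t.
Proof. by move=> /has_sum_lim <- /has_sum_lim. Qed.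

Lemma eq_has_sum I (f g : I -> K) s : f =1 g -> has_sum f s -> has_sum g s.
Proof. by move=> /funext ->. Qed.

Lemma eq_has_sum_on I (P Q : pred I) (f g : I -> K) s :
  P =1 Q -> {in P, f =1 g} -> has_sum_on P f s -> has_sum_on Q g s.
Proof.
move=> PQ fg; rewrite /has_sum_on; apply: eq_has_sum => i; rewrite -PQ.
by case: ifP => // /fg.
Qed.

Lemma has_sumD I (f g : I -> K) s t :
  has_sum f s -> has_sum g t -> has_sum (fun i => f i + g i) (s + t).
Proof.
move=> fs gt; rewrite /has_sum.
rewrite (_ : summability.partial_sum _ =
  summability.partial_sum f \+ summability.partial_sum g); first exact: cvgD.
by apply/funext => J; rewrite /summability.partial_sum big_split.
Qed.

Lemma has_sumZ I (c : K) (f : I -> K) s :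
  has_sum f s -> has_sum (fun i => c * f i) (c * s).
Proof.
move=> fs; rewrite /has_sum.
rewrite (_ : summability.partial_sum _ =
  (fun J => c * summability.partial_sum f J)); first exact: cvgM (cvg_cst c) fs.
by apply/funext => J; rewrite /summability.partial_sum mulr_sumr.
Qed.

Lemma has_sumB I (f g : I -> K) s t :
  has_sum f s -> has_sum g t -> has_sum (fun i => f i - g i) (s - t).
Proof.
move=> fs /(has_sumZ (c := -1)) /(has_sumD fs); rewrite mulN1r.
by apply: eq_has_sum => i; rewrite mulN1r.
Qed.

Lemma has_sum_onZ I (c : K) (P : pred I) (f : I -> K) s :
  has_sum_on P f s -> has_sum_on P (fun i => c * f i) (c * s).
Proof.
move=> fs; apply: eq_has_sum (has_sumZ fs) => i.
by case: ifP => //; rewrite mulr0.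
Qed.

Lemma has_sum_onID I (Q P : pred I) (f : I -> K) s t :
  has_sum_on (fun i => P i && Q i) f s ->
  has_sum_on (fun i => P i && ~~ Q i) f t -> has_sum_on P f (s + t).
Proof.
rewrite /has_sum_on => PQs /(has_sumD PQs); apply: eq_has_sum => i.
by case: (P i); case: (Q i); rewrite /= ?addr0 ?add0r.
Qed.

Lemma has_sum_onD I (P Q : pred I) (f : I -> K) s t :
  has_sum_on P f s -> has_sum_on (fun i => P i && Q i) f t ->
  has_sum_on (fun i => P i && ~~ Q i) f (s - t).
Proof.
rewrite /has_sum_on => Ps /(has_sumB Ps); apply: eq_has_sum => i.
by case: (P i); case: (Q i); rewrite /= ?subrr ?subr0.
Qed.

Lemma has_sum_seq I (r : seq I) (f : I -> K) :
  uniq r -> (forall i, i \notin r -> f i = 0) -> has_sum f (\sum_(i <- r) f i).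
Proof.
move=> r_uniq f0; apply/has_sumP => e e_gt0.
exists [fset i in r]%fset => J rJ.
suff -> : \sum_(i <- J) f i = \sum_(i <- r) f i by rewrite subrr normr0.
rewrite -(big_fset_incl _ rJ) => [|i _]; last by rewrite inE => /f0.
by apply: perm_big; apply: uniq_perm => // i; rewrite inE.
Qed.

Lemma has_sum_on_bij I (J : choiceType) (P : pred I) (Q : pred J)
    (h : I -> J) (h' : J -> I) (f : J -> K) s :
  (forall i, P i -> Q (h i)) -> (forall j, Q j -> P (h' j)) ->
  {in P, cancel h h'} -> {in Q, cancel h' h} ->
  has_sum_on Q f s -> has_sum_on P (f \o h) s.
Proof.
move=> PQ QP hK h'K /has_sum_onP fs; apply/has_sum_onP => e /fs[J0 J0P].
exists [fset h' j | j in J0]%fset => X J0X.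
pose hX := [seq h i | i <- X & P i].
suff -> : \sum_(i <- X | P i) f (h i) =
    \sum_(j <- ([fset j in hX] `|` J0)%fset | Q j) f j.
  by apply: J0P; exact: fsubsetUr.
rewrite -big_filter -(big_map h predT) -[RHS]big_filter; apply: perm_big.
apply: uniq_perm => [||j]; rewrite ?filter_uniq ?fset_uniq //.
  rewrite map_inj_in_uniq ?filter_uniq ?fset_uniq // => i i'.
  by rewrite !mem_filter => /andP[Pi _] /andP[Pi' _] /(congr1 h'); rewrite !hK.
rewrite mem_filter !inE; apply/idP/andP => [jX|[Qj /orP[//|jJ0]]].
  split; last by rewrite jX.
  by case/mapP: jX => i; rewrite mem_filter => /andP[/PQ Qhi _] ->.
rewrite -(h'K j Qj); apply: map_f; rewrite mem_filter QP //=.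
by apply: (fsubsetP J0X); exact: in_imfset.
Qed.

Lemma has_sum_on_exhaust I (P_ : nat -> pred I) (f : I -> K) s (s_ : nat -> K) :
  (forall i, \forall N \near \oo, P_ N i) ->
  (forall N, has_sum_on (P_ N) f (s_ N)) -> has_sum f s ->
  s_ N @[N --> \oo] --> s.
Proof.
move=> PT fs_ /has_sumP fs; apply/cvgrPdist_lt => e e_gt0.
have half_e_gt0 : 0 < e / 2 by rewrite divr_gt0.
have [J0 J0P] := fs _ half_e_gt0.
have : \forall N \near \oo, forall i, i \in J0 -> P_ N i.
  by apply: filter_bigI => i _; exact: PT.
apply: filterS => N J0P_; have /has_sum_onP/(_ _ half_e_gt0)[J1 J1P] := fs_ N.
pose J := (J0 `|` [fset i in J1 | P_ N i])%fset.
have sum_on_P_ : \sum_(i <- (J0 `|` J1)%fset | P_ N i) f i = \sum_(i <- J) f i.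
  rewrite -big_filter; apply: perm_big; apply: uniq_perm => [||i].
  - by rewrite filter_uniq ?fset_uniq.
  - exact: fset_uniq.
  rewrite mem_filter !inE andb_orr [X in _ || X]andbC.
  by congr (_ || _); rewrite andb_idl // => /J0P_.
have -> : s - s_ N = (s - \sum_(i <- J) f i)
    - (s_ N - \sum_(i <- (J0 `|` J1)%fset | P_ N i) f i).
  by rewrite sum_on_P_; ring.
rewrite [e]splitr; apply: le_lt_trans (ler_normB _ _) (ltrD _ _).
- by apply: J0P; exact: fsubsetUl.
- by apply: J1P; exact: fsubsetUr.
Qed.

Lemma has_sum_cvg_series (f : nat -> K) s :
  has_sum f s -> series f @ \oo --> s.
Proof.
apply: (@has_sum_on_exhaust _ (fun N i => (i < N)%N)) => [i|N].
  by exists i.+1.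
rewrite /series /= (_ : \sum_(0 <= i < N) f i =
    \sum_(i <- index_iota 0 N) if (i < N)%N then f i else 0).
  apply: has_sum_seq; first exact: iota_uniq.
  by move=> i; rewrite mem_index_iota /= => /negbTE ->.
by rewrite big_nat [RHS]big_nat; apply: eq_bigr => i /andP[_ ->].
Qed.

End HasSum.

Section ZSeriesSums.
Context {K : numFieldType}.
Implicit Types (I J : choiceType).

Lemma zsum_eq_zscale I J (F : I -> nat -> K) (G : J -> nat -> K) (c : K) :
  (forall n, exists2 s, has_sum (G ^~ n) s & has_sum (F ^~ n) (c * s)) ->
  [/\ zsummable F, zsummable G & zsum F = zscale c (zsum G)].
Proof.
move=> FG; split=> [n|n|].
- by have [s _ /has_sum_cvg] := FG n.
- by have [s /has_sum_cvg] := FG n.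
apply/funext => n; have [s Gs Fs] := FG n.
by rewrite /zscale /zsum (has_sum_lim Gs) (has_sum_lim Fs).
Qed.

Lemma has_sum_zmonom_inj I (c : I -> K) (d : I -> nat) i :
  injective d -> has_sum (fun j => zmonom (c j) (d j) (d i)) (c i).
Proof.
move=> d_inj.
have := @has_sum_seq K I [:: i] (fun j => zmonom (c j) (d j) (d i)) isT.
rewrite big_seq1 [zmonom (c i) _ _]/zmonom eqxx; apply=> j.
by rewrite inE /zmonom => /eqP ji; case: eqP => // /d_inj/esym.
Qed.

Lemma has_sum_zmonom_notin I (c : I -> K) (d : I -> nat) n :
  (forall i, d i != n) -> has_sum (fun i => zmonom (c i) (d i) n) 0.
Proof.
move=> dn; have := @has_sum_seq K I [::] (fun i => zmonom (c i) (d i) n) isT.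
by rewrite big_nil; apply=> i _; rewrite /zmonom eq_sym (negbTE (dn i)).
Qed.

End ZSeriesSums.

Lemma ler_sum_subset (K : numDomainType) (I : eqType) (r r' : seq I)
    (f : I -> K) :
  uniq r -> uniq r' -> {subset r <= r'} -> (forall i, 0 <= f i) ->
  \sum_(i <- r) f i <= \sum_(i <- r') f i.
Proof.
move=> r_uniq r'_uniq rr' f_ge0; rewrite [leRHS](bigID (mem r)) /=.
rewrite -[X in _ <= X + _]big_filter.
rewrite [X in _ <= X + _](perm_big r) /= ?lerDl ?sumr_ge0 //.
apply: uniq_perm; rewrite ?filter_uniq // => i; rewrite mem_filter /=.
by apply: andb_idr; exact: rr'.
Qed.

Section AbsoluteSummability.
Context {R : realType}.
Implicit Types (I : choiceType).

Lemma has_sum_ge0 I (f : I -> R) (M : R) :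
  (forall i, 0 <= f i) -> (forall J : {fset I}, \sum_(i <- J) f i <= M) ->
  exists s, has_sum f s.
Proof.
move=> f_ge0 fM; pose E := [set \sum_(i <- J) f i | J in [set: {fset I}]].
have E_sup : has_sup E.
  split; first by exists (\sum_(i <- fset0) f i), fset0.
  by exists M => _ [J _ <-].
exists (sup E); apply/has_sumP => e e_gt0.
have [_ [J0 _ <-] J0e] := sup_adherent e_gt0 E_sup.
exists J0 => J J0J.
have J0_le_J : \sum_(i <- J0) f i <= \sum_(i <- J) f i.
  by apply: ler_sum_subset => //; exact/fsubsetP.
have J_le_sup : \sum_(i <- J) f i <= sup E.
  by apply: sup_upper_bound => //; exists J.
rewrite ger0_norm ?subr_ge0 //; lra.
Qed.

Lemma has_sum_abs_real I (f : I -> R) (M : R) :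
  (forall J : {fset I}, \sum_(i <- J) `|f i| <= M) -> exists s, has_sum f s.
Proof.
move=> fM; have [s fs] := has_sum_ge0 (fun i => normr_ge0 (f i)) fM.
have [||t ft] := @has_sum_ge0 _ (fun i => `|f i| + f i) (M + M).
- by move=> i; rewrite addrC -lerBlDr sub0r lerNnormlW.
- move=> J; rewrite big_split lerD //= (le_trans _ (fM J)) //.
  by apply: ler_sum => i _; exact: ler_norm.
exists (t - s); apply: eq_has_sum (has_sumB ft fs) => i; ring.
Qed.

Local Open Scope complex_scope.

Lemma has_sum_real_complex I (f : I -> R) (s : R) :
  has_sum f s -> has_sum (fun i => (f i)%:C) s%:C.
Proof.
move=> /has_sumP fs; apply/has_sumP => e; rewrite ltcE /= => /andP[/eqP e_real].
move=> /fs[J0 J0P]; exists J0 => J /J0P.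
rewrite -rmorph_sum -rmorphB /= normc_def /= expr0n addr0 sqrtr_sqr.
by rewrite ltcE /= e_real eqxx.
Qed.

Lemma normc_ge_Im (z : R[i]) : `|complex.Im z|%:C <= `|z|.
Proof. by rewrite normc_def lecR -sqrtr_sqr ler_wsqrtr // lerDr sqr_ge0. Qed.

Lemma has_sum_abs I (f : I -> R[i]) (M : R[i]) :
  (forall J : {fset I}, \sum_(i <- J) `|f i| <= M) -> exists s, has_sum f s.
Proof.
move=> fM.
have summable_part (g : R[i] -> R) :
    (forall z, `|g z|%:C <= `|z|) -> exists s, has_sum (g \o f) s.
  move=> g_le; apply: (@has_sum_abs_real _ _ (complex.Re M)) => J.
  suff : (\sum_(i <- J) `|g (f i)|)%:C <= M by rewrite lecE => /andP[].
  apply: le_trans (fM J); rewrite rmorph_sum.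
  by apply: ler_sum => i _; exact: g_le.
have [s /has_sum_real_complex fs] := summable_part _ (@normc_ge_Re R).
have [t /has_sum_real_complex ft] := summable_part _ normc_ge_Im.
exists (s%:C + 'i * t%:C); apply: eq_has_sum (has_sumD fs (has_sumZ ft)) => i.
by rewrite -complexE.
Qed.

End AbsoluteSummability.

Section MonomialSums.
Context {K : numFieldType}.

Lemma sum_expr_le (y : K) n : 0 <= y < 1 -> \sum_(i < n) y ^+ i <= (1 - y)^-1.
Proof.
move=> /andP[y_ge0 y_lt1]; rewrite -[leRHS]mul1r ler_pdivlMr ?subr_gt0 //.
have -> : (\sum_(i < n) y ^+ i) * (1 - y) = 1 - y ^+ n.
  by rewrite mulrC -opprB mulNr -subrX1 opprB.
by rewrite gerBl exprn_ge0.
Qed.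

Lemma sum_fset_expr_le (y : K) (J : {fset nat}) :
  0 <= y < 1 -> \sum_(i <- J) y ^+ i <= (1 - y)^-1.
Proof.
move=> y01; have /andP[y_ge0 _] := y01.
pose n := (\max_(i <- J) i.+1)%N; apply: le_trans (sum_expr_le n y01).
rewrite -(big_mkord predT (GRing.exp y)); apply: ler_sum_subset => [|||i].
- exact: fset_uniq.
- exact: iota_uniq.
- by move=> i iJ; rewrite mem_index_iota /n (big_rem i) //= leq_maxl.
- exact: exprn_ge0.
Qed.

(* Expanding the product of the geometric series of the [x y]. *)
Lemma sum_monomials_le (T : finType) (x : T -> K)
    (J : {fset {ffun T -> nat}}) : (forall y, 0 <= x y < 1) ->
  \sum_(c <- J) \prod_y x y ^+ c y <= \prod_y (1 - x y)^-1.
Proof.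
move=> x01; have x_ge0 y : 0 <= x y by case/andP: (x01 y).
pose n := (\max_(c <- J) \max_y c y)%N.
pose widen (g : {ffun T -> 'I_n.+1}) := [ffun y => val (g y)].
apply: (@le_trans _ _
    (\sum_(c <- [seq widen g | g : {ffun T -> 'I_n.+1}]) \prod_y x y ^+ c y)).
  apply: ler_sum_subset => [|||c].
  - exact: fset_uniq.
  - rewrite map_inj_uniq ?enum_uniq // => g g' /ffunP gg'; apply/ffunP => y.
    by apply: val_inj; have := gg' y; rewrite !ffunE.
  - move=> c cJ; apply/codomP; exists [ffun y => inord (c y)].
    apply/ffunP => y; rewrite !ffunE /= inordK // ltnS /n (big_rem c) //=.
    by rewrite (leq_trans _ (leq_maxl _ _)) // leq_bigmax.
  - by apply: prodr_ge0 => y _; exact: exprn_ge0.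
rewrite big_image /=.
under eq_bigr do under eq_bigr do rewrite ffunE.
rewrite -(bigA_distr_bigA (fun y (k : 'I_n.+1) => x y ^+ k)).
apply: ler_prod => y _; rewrite sum_expr_le // andbT.
by apply: sumr_ge0 => k _; exact: exprn_ge0.
Qed.

End MonomialSums.

Section OneMinusPower.
Context {K : numDomainType}.
Implicit Types (x : K).

Lemma norm_expr_lt1 x m : `|x| < 1 -> (0 < m)%N -> `|x ^+ m| < 1.
Proof. by move=> x_lt1 m_gt0; rewrite normrX exprn_ilt1 // -lt0n. Qed.

Lemma expr1B_neq0 x m : `|x| < 1 -> (0 < m)%N -> 1 - x ^+ m != 0.
Proof.
move=> x_lt1 m_gt0; rewrite subr_eq0.
by apply: contraTneq (norm_expr_lt1 x_lt1 m_gt0) => <-; rewrite normr1 ltxx.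
Qed.

Lemma expr1D_neq0 x m : `|x| < 1 -> (0 < m)%N -> 1 + x ^+ m != 0.
Proof.
move=> x_lt1 m_gt0; rewrite addr_eq0; have := norm_expr_lt1 x_lt1 m_gt0.
by apply: contraTneq => xm; rewrite -normrN -xm normr1 ltxx.
Qed.

End OneMinusPower.

Section QPochhammerEstimates.
Context {K : numFieldType}.
Implicit Types (x q : K) (u : nat -> K).

Lemma norm_prod_1B_sub1_le u n : \sum_(i < n) `|u i| <= 2^-1 ->
  `|\prod_(i < n) (1 - u i) - 1| <= 2 * \sum_(i < n) `|u i|.
Proof.
elim: n => [|n IHn]; first by rewrite !big_ord0 subrr normr0 mulr0.
rewrite !big_ord_recr /=; set P := \prod_(i < n) _; set S := \sum_(i < n) _.
move=> S_le; have PB1_le : `|P - 1| <= 2 * S.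
  by apply: IHn; apply: le_trans S_le; rewrite lerDl.
have P_le2 : `|P| <= 2.
  rewrite -[P](subrK 1) (le_trans (ler_normD _ _)) // normr1 lerD2r.
  rewrite (le_trans PB1_le) // -ler_pdivlMl // mulr1.
  by apply: le_trans S_le; rewrite lerDl.
have -> : P * (1 - u n) - 1 = (P - 1) - P * u n by ring.
rewrite mulrDr (le_trans (ler_normB _ _)) // lerD // normrM.
by rewrite ler_wpM2r.
Qed.

Lemma qpochS x q n : qpoch x q n.+1 = qpoch x q n * (1 - x * q ^+ n).
Proof. by rewrite /qpoch big_ord_recr. Qed.

Lemma qpochD x q m n :
  qpoch x q (m + n) = qpoch x q m * qpoch (x * q ^+ m) q n.
Proof.
rewrite /qpoch big_split_ord; congr (_ * _); apply: eq_bigr => i _ /=.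
by rewrite exprD mulrA.
Qed.

Lemma qpoch_telescope x q n :
  qpoch x q n = 1 - \sum_(0 <= i < n) x * q ^+ i * qpoch x q i.
Proof.
elim: n => [|n IHn]; first by rewrite /qpoch big_ord0 big_geq ?subr0.
by rewrite qpochS big_nat_recr //= opprD addrA -IHn; ring.
Qed.

Lemma qpoch_neq0 x q n :
  (forall i, 1 - x * q ^+ i != 0) -> qpoch x q n != 0.
Proof. by move=> xq; apply/prodf_neq0. Qed.

(* The bound makes [\sum_i `|x * q ^+ i|] at most [1 / 4], which keeps every
   partial product within [1 / 2] of [1]. *)
Definition qpoch_small x q : bool := `|x| <= (1 - `|q|) / 4.

Lemma norm_qpoch_sub1_le x q n : `|q| < 1 -> qpoch_small x q ->
  `|qpoch x q n - 1| <= 2^-1.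
Proof.
move=> q_lt1 x_small.
have sum_le : \sum_(i < n) `|x * q ^+ i| <= 4^-1.
  under eq_bigr do rewrite normrM normrX.
  rewrite -mulr_sumr (le_trans (ler_pM _ _ x_small (sum_expr_le n _))) //.
  - by apply: sumr_ge0 => i _; exact: exprn_ge0.
  - by rewrite normr_ge0.
  - by rewrite mulrAC divff ?mul1r // subr_eq0 gt_eqF.
apply: le_trans (norm_prod_1B_sub1_le (u := fun i => x * q ^+ i) _) _.
  by rewrite (le_trans sum_le) // lef_pV2 ?posrE ?ler_nat.
apply: le_trans (ler_wpM2l _ sum_le) _ => //.
by rewrite (_ : 2 * 4^-1 = 2^-1) //; field.
Qed.

Lemma norm_qpoch_bounds x q n : `|q| < 1 -> qpoch_small x q ->
  2^-1 <= `|qpoch x q n| <= 2.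
Proof.
move=> q_lt1 /(norm_qpoch_sub1_le n q_lt1); set P := qpoch x q n => PB1_le.
apply/andP; split.
  have := lerB_dist 1 (1 - P); rewrite normr1 subKr distrC.
  apply: le_trans; rewrite lerBrDr -lerBrDl (le_trans PB1_le) //.
  by rewrite (_ : 1 - 2^-1 = 2^-1) //; field.
rewrite -[P](subrK 1) (le_trans (ler_normD _ _)) // normr1 -[leRHS]/(1 + 1).
by rewrite lerD2r (le_trans PB1_le) // invf_le1 // ler1n.
Qed.

End QPochhammerEstimates.

Section QPochhammerLimit.
Context {R : realType}.
(* The topology of [R[i]] is the one of its [numFieldType] structure. *)
Local Notation C := (R[i] : numFieldType).
Implicit Types (x q : C).

Lemma norm_lt1_cvg_expr q : `|q| < 1 -> q ^+ n @[n --> \oo] --> 0.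
Proof.
move=> q_lt1; have [J|s /has_sum_cvg_series geom] :=
  @has_sum_abs R nat (GRing.exp q) (1 - `|q|)^-1.
  by under eq_bigr do rewrite normrX; rewrite sum_fset_expr_le ?normr_ge0.
by apply: cvg_series_cvg_0; apply/cvg_ex; exists s.
Qed.

Lemma qpoch_small_shift x q : `|q| < 1 ->
  exists N, qpoch_small (x * q ^+ N) q.
Proof.
move=> q_lt1; have : x * q ^+ n @[n --> \oo] --> x * 0.
  exact: cvgM (cvg_cst x) (norm_lt1_cvg_expr q_lt1).
rewrite mulr0 => /cvgr0_norm_le /(_ ((1 - `|q|) / 4)).
by rewrite divr_gt0 ?subr_gt0 // => /(_ isT)[N _ /(_ N (leqnn N))]; exists N.
Qed.

Lemma is_cvg_qpoch_small x q : `|q| < 1 -> qpoch_small x q ->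
  cvgn (qpoch x q).
Proof.
move=> q_lt1 x_small.
have [J|s /has_sum_cvg_series fs] := @has_sum_abs R nat
    (fun i => x * q ^+ i * qpoch x q i) (`|x| * 2 * (1 - `|q|)^-1).
  apply: (@le_trans _ _ (\sum_(i <- J) `|x| * 2 * `|q| ^+ i)); last first.
    by rewrite -mulr_sumr ler_wpM2l ?mulr_ge0 // sum_fset_expr_le ?normr_ge0.
  apply: ler_sum => i _.
  have /andP[_ qpoch_le2] := norm_qpoch_bounds i q_lt1 x_small.
  by rewrite !normrM normrX mulrAC ler_wpM2r ?exprn_ge0 // ler_wpM2l.
apply/cvg_ex; exists (1 - s); rewrite (funext (qpoch_telescope x q)).
by apply: cvgB; first exact: cvg_cst.
Qed.

Lemma cvg_qpoch_shift x q N (l : C) :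
  qpoch (x * q ^+ N) q @ \oo --> l -> qpoch x q @ \oo --> qpoch x q N * l.
Proof.
move=> xN_cvg; rewrite -(cvg_shiftn N) /=.
rewrite (_ : (fun n => _) = (fun n => qpoch x q N * qpoch (x * q ^+ N) q n)).
  by apply: cvgM; first exact: cvg_cst.
by apply/funext => n; rewrite addnC qpochD.
Qed.

Lemma cvg_qpoch x q : `|q| < 1 -> qpoch x q @ \oo --> qpoch_infty x q.
Proof.
move=> q_lt1; suff : cvgn (qpoch x q) by [].
have [N xN_small] := qpoch_small_shift x q_lt1.
have /cvg_qpoch_shift xN_cvg := is_cvg_qpoch_small q_lt1 xN_small.
by apply/cvg_ex; eexists; exact: xN_cvg.
Qed.

Lemma qpoch_infty_neq0 x q : `|q| < 1 -> (forall i, 1 - x * q ^+ i != 0) ->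
  qpoch_infty x q != 0.
Proof.
move=> q_lt1 xq; have [N xN_small] := qpoch_small_shift x q_lt1.
have -> : qpoch_infty x q = qpoch x q N * qpoch_infty (x * q ^+ N) q.
  apply: cvg_lim; first exact: norm_hausdorff.
  by apply: cvg_qpoch_shift; exact: cvg_qpoch.
rewrite mulf_neq0 ?qpoch_neq0 //; apply/eqP => lim0.
have := @cvg_qpoch (x * q ^+ N) q q_lt1.
rewrite lim0 => /cvgr0_norm_lt /(_ 2^-1).
rewrite invr_gt0 ltr0n => /(_ isT)[n _ /(_ n (leqnn n))] /=.
have /andP[ge_half _] := norm_qpoch_bounds n q_lt1 xN_small.
by move=> /(le_lt_trans ge_half); rewrite ltxx.
Qed.

Lemma qpoch_inv_bounded x q : `|q| < 1 -> (forall i, 1 - x * q ^+ i != 0) ->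
  exists M, forall n, `|(qpoch x q n)^-1| <= M.
Proof.
move=> q_lt1 xq.
have /cvg_seq_bounded/pinfty_ex_gt0[M _ MP] : cvgn (fun n => (qpoch x q n)^-1).
  apply/cvg_ex; exists (qpoch_infty x q)^-1.
  by apply: cvgV; [exact: qpoch_infty_neq0|exact: cvg_qpoch].
by exists M => n; exact: MP.
Qed.

End QPochhammerLimit.

Lemma uniq_filter_pairwise (T : eqType) (a : pred T) (s : seq T) :
  uniq [seq x <- s | a x] = pairwise [rel x y | a x && a y ==> (x != y)] s.
Proof.
rewrite uniq_pairwise; elim: s => //= x s IHs; case: ifP => ax /=; rewrite IHs.
  by rewrite all_filter; congr (_ && _); apply: eq_all => y /=; rewrite ax.
rewrite [X in _ = X && _](eq_all (a2 := predT)) ?all_predT // => y /=.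
by rewrite ax.
Qed.

Section PartInsertion.
Implicit Types (p : overpartition) (x y : nat * bool).

(* At equal value the overlined part comes first, as [false < true]. *)
Definition part_ge : rel (nat * bool) :=
  fun x y => (y <= x :> (nat *l bool))%O.

Lemma part_ge_trans : transitive part_ge.
Proof. by move=> y x z yx zy; exact: le_trans zy yx. Qed.

Lemma part_ge_anti : antisymmetric part_ge.
Proof. by move=> x y; rewrite andbC => /(@le_anti _ (nat *l bool)%type). Qed.

Lemma is_overpartitionE (s : seq (nat * bool)) :
  is_overpartition s =
  [&& all [pred x | (0 < x.1)%N] s, sorted part_ge s
    & uniq [seq x <- s | x.2]].
Proof.
rewrite /is_overpartition uniq_filter_pairwise (sorted_pairwise part_ge_trans).
rewrite sorted_pairwise => [|k m n mk kn]; last exact: leq_trans kn mk.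
rewrite pairwise_map -!pairwise_relI; congr (_ && _).
apply: eq_pairwise => -[m b] [n c] /=.
rewrite /part_ge lexi_pair xpair_eqE !leEnat.
by case: (ltngtP m n); case: b; case: c.
Qed.

Lemma overpartition_perm_inj p p' : perm_eq p p' -> p = p'.
Proof.
move=> pp'; apply: val_inj => /=.
have := valP p; rewrite is_overpartitionE => /and3P[_ p_sorted _].
have := valP p'; rewrite is_overpartitionE => /and3P[_ p'_sorted _].
exact: (sorted_eq part_ge_trans part_ge_anti p_sorted p'_sorted pp').
Qed.

Lemma part_gt0 p x : x \in op_parts p -> (0 < x.1)%N.
Proof. by have /and3P[/allP p_gt0 _ _] := valP p; exact: p_gt0. Qed.

Lemma part_le_weight p x : x \in op_parts p -> (x.1 <= weight p)%N.
Proof. by move=> xp; rewrite [leqRHS]/weight (big_rem _ xp) leq_addr. Qed.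

Definition insertable x p : bool :=
  (0 < x.1)%N && (x.2 ==> (x \notin op_parts p)).

Definition insert_part x p : overpartition := insubd p (sort part_ge (x :: p)).

Definition delete_part x p : overpartition := insubd p (rem x p).

Lemma perm_insert_part x p :
  insertable x p -> perm_eq (insert_part x p) (x :: p).
Proof.
move=> /andP[x_gt0 x_new]; rewrite /insert_part [X in perm_eq X]val_insubd.
suff -> : is_overpartition (sort part_ge (x :: p)) by rewrite perm_sort.
have := valP p; rewrite !is_overpartitionE => /and3P[p_gt0 _ p_uniq].
apply/and3P; split; first by rewrite all_sort /= x_gt0.
  by apply: sort_sorted => y z; exact: le_total.
rewrite (perm_uniq (perm_filter _ (permEl (perm_sort _ _)))) /=.
by case: ifP x_new => //= x_over x_new; rewrite mem_filter negb_and x_new orbT.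
Qed.

Lemma perm_delete_part x p :
  x \in op_parts p -> perm_eq p (x :: delete_part x p).
Proof.
move=> xp; suff -> : delete_part x p = rem x p :> seq _ by exact: perm_to_rem.
rewrite [LHS]val_insubd; suff -> : is_overpartition (rem x p) by [].
have := valP p; rewrite !is_overpartitionE => /and3P[p_gt0 p_sorted p_uniq].
have rem_sub := rem_subseq x p; apply/and3P; split.
- by apply/allP => y /(mem_subseq rem_sub)/(allP p_gt0).
- exact: subseq_sorted part_ge_trans _ _ rem_sub p_sorted.
- apply: subseq_uniq p_uniq; rewrite subseq_filter filter_all.
  exact: subseq_trans (filter_subseq _ _) rem_sub.
Qed.

Lemma insertable_delete x p :
  x \in op_parts p -> insertable x (delete_part x p).
Proof.
move=> xp; rewrite /insertable (part_gt0 xp); apply/implyP => x_over.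
have := valP p; rewrite is_overpartitionE => /and3P[_ _].
rewrite (perm_uniq (perm_filter _ (perm_delete_part xp))) /= x_over /=.
by rewrite mem_filter x_over => /andP[].
Qed.

Lemma mem_insert_part x y p : insertable x p ->
  (y \in op_parts (insert_part x p)) = (y == x) || (y \in op_parts p).
Proof. by move=> /perm_insert_part/perm_mem ->; rewrite inE. Qed.

Lemma count_insert_part (a : pred (nat * bool)) x p : insertable x p ->
  count a (insert_part x p) = (a x + count a p)%N.
Proof. by move=> /perm_insert_part/permP ->. Qed.

Lemma insert_partK x p : insertable x p -> delete_part x (insert_part x p) = p.
Proof.
move=> x_new; apply: overpartition_perm_inj.
rewrite -(perm_cons x) -(permPr (perm_insert_part x_new)) perm_sym.
by apply: perm_delete_part; rewrite mem_insert_part // eqxx.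
Qed.

Lemma delete_partK x p :
  x \in op_parts p -> insert_part x (delete_part x p) = p.
Proof.
move=> xp; apply: overpartition_perm_inj.
rewrite (permPl (perm_insert_part (insertable_delete xp))) perm_sym.
exact: perm_delete_part.
Qed.

Lemma weight_delete_part x p :
  x \in op_parts p -> weight p = (x.1 + weight (delete_part x p))%N.
Proof.
by move=> xp; rewrite /weight (perm_big _ (perm_delete_part xp)) big_cons.
Qed.

End PartInsertion.

Section Multiplicities.
Implicit Types (p : overpartition).

Definition multiplicity N p : {ffun 'I_N * bool -> nat} :=
  [ffun y : 'I_N * bool => count_mem (y.1.+1 : nat, y.2) p].

Lemma multiplicity_inj N p p' : (weight p <= N)%N -> (weight p' <= N)%N ->
  multiplicity N p = multiplicity N p' -> p = p'.
Proof.
move=> pN p'N /ffunP pp'; apply: overpartition_perm_inj.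
apply/allP => -[m b] _ /=; apply/eqP.
case: (boolP (0 < m <= N)%N) => [/andP[m_gt0 mN]|m_out].
  have mN' : (m.-1 < N)%N by rewrite prednK.
  by have := pp' (Ordinal mN', b); rewrite !ffunE /= prednK.
have notin p'' : (weight p'' <= N)%N -> (m, b) \notin op_parts p''.
  move=> p''N; apply: contra m_out => mp1; rewrite (part_gt0 mp1) /=.
  exact: leq_trans (part_le_weight mp1) p''N.
by rewrite !(count_memPn _) ?notin.
Qed.

Lemma weight_multiplicity N p : (weight p <= N)%N ->
  weight p = (\sum_(y : 'I_N * bool) y.1.+1 * multiplicity N p y)%N.
Proof.
move=> pN; under [RHS]eq_bigr do rewrite ffunE -sum1_count big_distrr /=.
rewrite (exchange_big_dep predT) //= /weight big_seq [RHS]big_seq.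
apply: eq_bigr => -[m b] mp /=; have m_gt0 := part_gt0 mp.
have mN : (m.-1 < N)%N.
  by rewrite prednK // (leq_trans (part_le_weight mp)).
rewrite (big_pred1 (Ordinal mN, b)) /= ?muln1 ?prednK // => -[i c] /=.
rewrite !xpair_eqE -val_eqE /=; congr (_ && _); last exact: eq_sym.
by rewrite -[m in LHS]prednK // eqSS eq_sym.
Qed.

Lemma sum_weight_le (K : numFieldType) (t : K) N (J : {fset overpartition}) :
  0 <= t < 1 -> (forall p, p \in J -> (weight p <= N)%N) ->
  \sum_(p <- J) t ^+ weight p <= (qpoch t t N)^-1 ^+ 2.
Proof.
move=> /andP[t_ge0 t_lt1] weight_leN.
have -> : \sum_(p <- J) t ^+ weight p =
    \sum_(c <- [fset multiplicity N p | p in J]%fset)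
      \prod_(y : 'I_N * bool) (t ^+ y.1.+1) ^+ c y.
  rewrite big_imfset /= => [|p p' pJ p'J]; last first.
    by apply: multiplicity_inj; exact: weight_leN.
  rewrite big_seq [RHS]big_seq; apply: eq_bigr => p pJ.
  rewrite [in LHS](weight_multiplicity (weight_leN p pJ)) expr_sum.
  by apply: eq_bigr => y _; rewrite exprM.
apply: le_trans (sum_monomials_le _ _) _ => [y|].
  by rewrite exprn_ge0 //= exprn_ilt1.
rewrite -(pair_bigA _ (fun (i : 'I_N) (b : bool) => (1 - t ^+ i.+1)^-1)) /=.
under eq_bigr do rewrite big_bool /= -expr2.
rewrite prodrXl /qpoch -prodfV le_eqVlt; apply/orP; left; apply/eqP.
by congr (_ ^+ 2); apply: eq_bigr => i _; rewrite exprS.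
Qed.

Lemma sum_weight_bounded (R : realType) (t : R[i]) : 0 <= t < 1 ->
  exists M, forall J : {fset overpartition}, \sum_(p <- J) t ^+ weight p <= M.
Proof.
move=> t01; have /andP[t_ge0 t_lt1] := t01.
have norm_t_lt1 : `|t| < 1 by rewrite ger0_norm.
have [|M qpoch_inv_le] := qpoch_inv_bounded (x := t) norm_t_lt1.
  by move=> i; rewrite -exprS expr1B_neq0.
exists (M ^+ 2) => J; pose N := (\max_(p <- J) weight p)%N.
apply: le_trans (sum_weight_le (N := N) t01 _) _ => [p pJ|].
  by rewrite /N (big_rem p) //= leq_maxl.
have qpoch_inv_ge0 : 0 <= (qpoch t t N)^-1.
  rewrite invr_ge0; apply: prodr_ge0 => i _.
  by rewrite -exprS subr_ge0 exprn_ile1 // ltW.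
have {}qpoch_inv_le : (qpoch t t N)^-1 <= M by rewrite -[leLHS]ger0_norm.
by rewrite lerXn2r ?nnegrE // (le_trans qpoch_inv_ge0).
Qed.

End Multiplicities.

Section GeneratingFunctions.
Context {R : realType} (q : R[i]).
Hypothesis q_lt1 : `|q| < 1.
Implicit Types (p : overpartition) (P Q : pred overpartition) (m : nat).

Definition has_gf P (s : R[i]) : Prop :=
  has_sum_on P (fun p => q ^+ weight p) s.

Lemma has_gf_ex P : exists s, has_gf P s.
Proof.
have [|M MP] := sum_weight_bounded (t := `|q|); first by rewrite normr_ge0.
apply: (@has_sum_abs _ _ _ M) => J; apply: le_trans (MP J).
apply: ler_sum => p _; case: ifP => _; first by rewrite normrX.
by rewrite normr0 exprn_ge0.
Qed.

Lemma has_gf_unique P s t : has_gf P s -> has_gf P t -> s = t.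
Proof. exact: has_sum_unique. Qed.

Lemma eq_has_gf P Q s : P =1 Q -> has_gf P s -> has_gf Q s.
Proof. by move=> PQ; exact: eq_has_sum_on. Qed.

Lemma has_gf_insert x P Q s :
  (forall p, P p -> insertable x p && Q (insert_part x p)) ->
  (forall p, Q p -> (x \in op_parts p) && P (delete_part x p)) ->
  has_gf P s -> has_gf Q (q ^+ x.1 * s).
Proof.
move=> PQ QP /(has_sum_onZ (c := q ^+ x.1)).
move=> /(has_sum_on_bij (P := Q) (h := delete_part x) (h' := insert_part x)) gf.
apply: eq_has_sum_on (gf _ _ _ _) => // p.
- by move=> /QP/andP[xp _] /=; rewrite (weight_delete_part xp) exprD.
- by case/QP/andP.
- by case/PQ/andP.
- by move=> /QP/andP[xp _]; exact: delete_partK.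
- by move=> /PQ/andP[x_new _]; exact: insert_partK.
Qed.

Definition ignores_part x P : Prop :=
  forall p, insertable x p -> P (insert_part x p) = P p.

Lemma ignores_part_delete x P p :
  ignores_part x P -> x \in op_parts p -> P (delete_part x p) = P p.
Proof.
move=> Px xp; rewrite -[in RHS](delete_partK xp) Px //.
exact: insertable_delete.
Qed.

Lemma ignores_other_part x y P : x != y -> ignores_part x P ->
  ignores_part x (fun p => P p && (y \notin op_parts p)).
Proof.
move=> xy Px p x_new; rewrite Px // mem_insert_part //.
by rewrite negb_or eq_sym xy.
Qed.

Lemma has_gf_overlined m P s : (0 < m)%N -> ignores_part (m, true) P ->
  has_gf (fun p => P p && ((m, true) \notin op_parts p)) s ->
  has_gf (fun p => P p && ((m, true) \in op_parts p)) (q ^+ m * s).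
Proof.
move=> m_gt0 Pm; apply: (has_gf_insert (x := (m, true))) => p /andP[Pp mp].
  have m_new : insertable (m, true) p by rewrite /insertable m_gt0 mp.
  by rewrite m_new Pm // Pp mem_insert_part // eqxx.
rewrite mp ignores_part_delete // Pp /=.
by have /andP[] := insertable_delete mp.
Qed.

Lemma has_gf_not_overlined m P s : (0 < m)%N -> ignores_part (m, true) P ->
  has_gf P s ->
  has_gf (fun p => P p && ((m, true) \notin op_parts p)) (s / (1 + q ^+ m)).
Proof.
move=> m_gt0 Pm Ps.
have [t t_gf] := has_gf_ex (fun p => P p && ((m, true) \notin op_parts p)).
suff -> : s = t * (1 + q ^+ m) by rewrite mulfK ?expr1D_neq0.
have := has_sum_onID (has_gf_overlined m_gt0 Pm t_gf) t_gf.
by move=> /(has_gf_unique Ps) ->; ring.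
Qed.

Lemma has_gf_copies m j P s : (0 < m)%N -> ignores_part (m, false) P ->
  has_gf P s ->
  has_gf (fun p => P p && (j <= count_mem (m, false) p)%N) (q ^+ (m * j) * s).
Proof.
move=> m_gt0 Pm Ps; elim: j => [|j IHj].
  by rewrite muln0 mul1r; apply: eq_has_gf Ps => p; rewrite andbT.
rewrite mulnS exprD -mulrA.
apply: (has_gf_insert (x := (m, false))) IHj => p /andP[Pp jp].
  have m_new : insertable (m, false) p by rewrite /insertable m_gt0.
  by rewrite m_new Pm // Pp count_insert_part //= eqxx.
have mp : (m, false) \in op_parts p.
  by rewrite -has_pred1 has_count (leq_ltn_trans _ jp).
rewrite mp ignores_part_delete // Pp /= -ltnS (leq_trans jp) //.
by have /permP -> := perm_delete_part mp; rewrite /= eqxx.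
Qed.

Lemma has_gf_not_overlined_copies m j P s : (0 < m)%N ->
  (forall b, ignores_part (m, b) P) -> has_gf P s ->
  has_gf (fun p => [&& P p, (m, true) \notin op_parts p
                     & (j <= count_mem (m, false) p)%N])
    (q ^+ (m * j) * (s / (1 + q ^+ m))).
Proof.
move=> m_gt0 Pm /(has_gf_not_overlined m_gt0 (Pm true)).
move=> /(has_gf_copies (j := j) m_gt0) copies.
apply: eq_has_gf (copies _) => [p|]; first by rewrite -andbA.
by apply: ignores_other_part (Pm false); rewrite xpair_eqE andbF.
Qed.

Definition saturated r m p : bool :=
  ((m, true) \in op_parts p) || (r.-1 <= count_mem (m, false) p)%N.

Definition saturation_ratio r m : R[i] :=
  q ^+ m * (1 + q ^+ ((r - 2) * m)) / (1 + q ^+ m).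

Lemma has_gf_saturated r m P s : (2 <= r)%N -> (0 < m)%N ->
  (forall b, ignores_part (m, b) P) -> has_gf P s ->
  has_gf (fun p => P p && saturated r m p) (s * saturation_ratio r m).
Proof.
move=> r_ge2 m_gt0 Pm Ps.
have not_overlined := has_gf_not_overlined m_gt0 (Pm true) Ps.
have -> : s * saturation_ratio r m =
    q ^+ m * (s / (1 + q ^+ m)) + q ^+ (m * r.-1) * (s / (1 + q ^+ m)).
  have -> : (m * r.-1 = m + (r - 2) * m)%N.
    by case: r r_ge2 => [|[|r]] // _; lia.
  by rewrite /saturation_ratio exprD; ring.
apply: (has_sum_onID (Q := fun p => (m, true) \in op_parts p)).
  apply: eq_has_gf (has_gf_overlined m_gt0 (Pm true) not_overlined) => p.
  by rewrite /saturated; case: (_ \in _); rewrite ?andbF ?andbT.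
apply: eq_has_gf (has_gf_not_overlined_copies (j := r.-1) m_gt0 Pm Ps) => p.
by rewrite /saturated; case: (_ \in _); rewrite ?andbF ?andbT.
Qed.

Lemma ignores_part_saturated r x m :
  x.1 != m -> ignores_part x (saturated r m).
Proof.
move=> xm p x_new; rewrite /saturated mem_insert_part // count_insert_part //=.
have x_neq b : (x == (m, b)) = false.
  by apply/negbTE; apply: contra xm => /eqP ->.
by rewrite eq_sym !x_neq.
Qed.

Lemma has_gf_all_saturated r (ms : seq nat) s : (2 <= r)%N ->
  all (ltn 0) ms -> uniq ms -> has_gf xpredT s ->
  has_gf (fun p => all (fun m => saturated r m p) ms)
    (s * \prod_(m <- ms) saturation_ratio r m).
Proof.
move=> r_ge2 + + s_gf; elim: ms => [|m ms IHms].
  by move=> _ _; rewrite big_nil mulr1.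
move=> /andP[m_gt0 /IHms{}IHms] /andP[m_notin /IHms{}IHms].
rewrite big_cons mulrCA mulrC.
apply: eq_has_gf (has_gf_saturated r_ge2 m_gt0 _ IHms) => [p|b p x_new].
  by rewrite andbC.
apply: eq_in_all => m' m'_in; apply: ignores_part_saturated => //=.
by apply: contraNneq m_notin => ->.
Qed.

Definition parts_le N p : bool := all [pred x | (x.1 <= N)%N] (op_parts p).

Lemma parts_leS N p : parts_le N p =
  [&& parts_le N.+1 p, (N.+1, true) \notin op_parts p
    & (N.+1, false) \notin op_parts p].
Proof.
apply/idP/and3P => [/allP pN|[/allP pN no_true no_false]].
  split; first by apply/allP => x /pN /= /leqW.
  - by apply/negP => /pN /=; rewrite ltnn.
  - by apply/negP => /pN /=; rewrite ltnn.
apply/allP => -[m b] mp /=; have /= := pN _ mp; rewrite leq_eqVlt.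
case/predU1P=> [mN|//]; move: mp no_true no_false; rewrite mN.
by case: b => ->.
Qed.

Lemma ignores_part_parts_le N x : (x.1 <= N)%N -> ignores_part x (parts_le N).
Proof.
move=> xN p x_new; rewrite /parts_le (perm_all _ (perm_insert_part x_new)) /=.
by rewrite xN.
Qed.

Lemma parts_le_weight p : parts_le (weight p) p.
Proof. by apply/allP => x; exact: part_le_weight. Qed.

Lemma has_gf_omit m P s : (0 < m)%N -> (forall b, ignores_part (m, b) P) ->
  has_gf P s ->
  has_gf (fun p => [&& P p, (m, true) \notin op_parts p
                     & (m, false) \notin op_parts p])
    (s * (1 - q ^+ m) / (1 + q ^+ m)).
Proof.
move=> m_gt0 Pm Ps.
have not_overlined := has_gf_not_overlined m_gt0 (Pm true) Ps.
have -> : s * (1 - q ^+ m) / (1 + q ^+ m) =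
    s / (1 + q ^+ m) - q ^+ (m * 1) * (s / (1 + q ^+ m)).
  by rewrite muln1; ring.
have one_copy := has_gf_not_overlined_copies (j := 1) m_gt0 Pm Ps.
have := has_sum_onD (Q := fun p => (m, false) \in op_parts p) not_overlined.
move=> /(_ _ (eq_has_gf _ one_copy)) omit; apply: eq_has_gf (omit _) => p.
  by rewrite andbA.
by rewrite -andbA -has_count has_pred1.
Qed.

Lemma has_gf_parts_le0 : has_gf (parts_le 0) 1.
Proof.
pose empty := @Overpartition [::] isT.
have parts_le0 p : parts_le 0 p = (p == empty).
  apply/allP/eqP => [p0|-> //]; apply: val_inj => /=.
  case pE : (op_parts p) => [//|x s].
  have xp : x \in op_parts p by rewrite pE mem_head.
  by have := p0 x xp; rewrite /= leqNgt (part_gt0 xp).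
pose f p := if parts_le 0 p then q ^+ weight p else 0.
have -> : 1 = \sum_(p <- [:: empty]) f p.
  by rewrite big_seq1 /f parts_le0 eqxx /weight big_nil.
by apply: has_sum_seq => // p; rewrite inE /f parts_le0 => /negbTE ->.
Qed.

Lemma has_gf_parts_le N :
  has_gf (parts_le N) (qpoch (- q) q N / qpoch q q N).
Proof.
elim: N => [|N IHN].
  by rewrite /qpoch !big_ord0 divr1; exact: has_gf_parts_le0.
have [s s_gf] := has_gf_ex (parts_le N.+1).
suff <- : s = qpoch (- q) q N.+1 / qpoch q q N.+1 by [].
have omit_gf : has_gf (parts_le N) (s * (1 - q ^+ N.+1) / (1 + q ^+ N.+1)).
  apply: eq_has_gf (has_gf_omit (ltn0Sn N) _ s_gf) => [p|b].
    by rewrite -parts_leS.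
  exact: ignores_part_parts_le.
rewrite !qpochS mulNr opprK -!exprS invfM mulrACA (has_gf_unique IHN omit_gf).
have qN_neq0 : 1 - q ^+ N.+1 != 0 by rewrite expr1B_neq0.
by rewrite mulrA divfK ?mulfK ?expr1D_neq0.
Qed.

Lemma has_gf_overpartitions :
  has_gf xpredT (qpoch_infty (- q) q / qpoch_infty q q).
Proof.
have [s s_gf] := has_gf_ex xpredT.
suff -> : qpoch_infty (- q) q / qpoch_infty q q = s by [].
have qq_neq0 : qpoch_infty q q != 0.
  apply: qpoch_infty_neq0 => // i.
  by rewrite -exprS expr1B_neq0.
have ratio_cvg : qpoch (- q) q N / qpoch q q N @[N --> \oo] -->
    qpoch_infty (- q) q / qpoch_infty q q.
  by apply: cvgM; [exact: cvg_qpoch|apply: cvgV => //; exact: cvg_qpoch].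
apply: cvg_unique ratio_cvg _; first exact: norm_hausdorff.
apply: has_sum_on_exhaust has_gf_parts_le s_gf => p.
exists (weight p) => // N /= pN; apply: sub_all (parts_le_weight p) => x /=.
by move=> /leq_trans; apply.
Qed.

End GeneratingFunctions.

Lemma eqn_mod_progression A a m : (0 < a <= A)%N -> (0 < m)%N ->
  m == a %[mod A] -> exists k, m = (k * A + a)%N.
Proof.
case: a m => [|a] [|m] //= aA _; rewrite -[a.+1]addn1 -[m.+1]addn1 eqn_modDr.
move=> /eqP ma; exists (m %/ A)%N.
by rewrite addnA {1}(divn_eq m A) ma modn_small.
Qed.

Section MesCoefficients.
Context {R : realType} (A a r : nat) (q : R[i]).
Hypotheses (a_gt0 : (0 < a)%N) (aA : (a <= A)%N) (r_ge2 : (2 <= r)%N).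
Implicit Types (p : overpartition) (k : nat).

Let A_gt0 : (0 < A)%N := leq_trans a_gt0 aA.

Definition progression k : seq nat := mkseq (fun i => i * A + a)%N k.

Lemma progressionP m k :
  reflect (exists2 i, (i < k)%N & m = (i * A + a)%N) (m \in progression k).
Proof.
by apply: (iffP mapP) => [[i ik ->]|[i ik ->]]; exists i => //;
  rewrite mem_iota in ik *.
Qed.

Lemma progressionS k : progression k.+1 = rcons (progression k) (k * A + a)%N.
Proof. by rewrite /progression /mkseq -[k.+1]addn1 iotaD map_cat cats1. Qed.

Lemma progression_inj : injective (fun i => i * A + a)%N.
Proof. by move=> i j /addIn/eqP; rewrite eqn_pmul2r // => /eqP. Qed.

Definition saturation_product k : R[i] :=
  q ^+ (A * 'C(k, 2) + k * a) / qpoch (- q ^+ a) (q ^+ A) k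
    * qpoch (- q ^+ ((r - 2) * a)) (q ^+ ((r - 2) * A)) k.

Lemma prod_saturation_ratio k :
  \prod_(m <- progression k) saturation_ratio q r m = saturation_product k.
Proof.
elim: k => [|k IHk].
  by rewrite big_nil /saturation_product /qpoch !big_ord0 muln0 divr1 mulr1.
rewrite progressionS -cats1 big_cat big_seq1 /= IHk.
rewrite /saturation_product /saturation_ratio.
rewrite !qpochS !mulNr !opprK -!exprM -!exprD binS bin1 invfM.
have -> : (a + A * k = k * A + a)%N by lia.
have -> : ((r - 2) * a + (r - 2) * A * k = (r - 2) * (k * A + a))%N by lia.
have -> : (A * ('C(k, 2) + k) + k.+1 * a
    = A * 'C(k, 2) + k * a + (k * A + a))%N.
  by lia.
by rewrite [in RHS]exprD; ring.
Qed.

Lemma mes_pred_saturated p k :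
  mes_pred r A a p (k * A + a)%N = ~~ saturated r (k * A + a) p.
Proof.
rewrite /mes_pred /saturated modnMDl eqxx addn_gt0 a_gt0 orbT negb_or.
by rewrite -ltnNge.
Qed.

Lemma mes_in_progression p : exists k, mes r A a p = (k * A + a)%N.
Proof.
have [/and4P[mes_gt0 mes_mod _ _] _] := mesP a p A_gt0 r_ge2.
by apply: eqn_mod_progression => //; rewrite a_gt0.
Qed.

Lemma mes_eq p k : (mes r A a p == k * A + a)%N =
  all (fun m => saturated r m p) (progression k)
    && ~~ saturated r (k * A + a) p.
Proof.
have [mesp mes_min] := mesP a p A_gt0 r_ge2.
have [k' mesE] := mes_in_progression p.
have mes_le i : ~~ saturated r (i * A + a) p -> (k' <= i)%N.
  by rewrite -mes_pred_saturated => /mes_min; rewrite mesE leq_add2r leq_pmul2r.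
move: mesp; rewrite mesE mes_pred_saturated => unsat.
rewrite eqn_add2r eqn_pmul2r //; apply/eqP/andP => [<-|[/allP sat /mes_le k'k]].
  split=> //; apply/allP => _ /progressionP[i ik' ->].
  by apply: contraLR ik' => /mes_le; rewrite -leqNgt.
apply/eqP; rewrite eqn_leq k'k leqNgt; apply: contra unsat => kk'.
by apply: sat; apply/progressionP; exists k'.
Qed.

Lemma has_gf_mes_eq k : `|q| < 1 ->
  has_gf q (fun p => (k * A + a)%N == mes r A a p)
    (qpoch_infty (- q) q / qpoch_infty q q
       * (saturation_product k - saturation_product k.+1)).
Proof.
move=> q_lt1; have saturated_gf j : has_gf q
    (fun p => all (fun m => saturated r m p) (progression j))
    (qpoch_infty (- q) q / qpoch_infty q q * saturation_product j).
  rewrite -prod_saturation_ratio; apply: has_gf_all_saturated => //.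
  - by apply/allP => _ /progressionP[i _ ->]; rewrite /= addn_gt0 a_gt0 orbT.
  - by rewrite map_inj_uniq ?iota_uniq //; exact: progression_inj.
  - exact: has_gf_overpartitions.
rewrite mulrBr; have := has_sum_onD (saturated_gf k).
move=> /(_ _ _ (eq_has_gf _ (saturated_gf k.+1))) gf.
apply: eq_has_gf (gf _ _) => p; first by rewrite eq_sym mes_eq.
by rewrite progressionS all_rcons andbC.
Qed.

End MesCoefficients.

Theorem theorem2p8 (R : realType) (A a r : nat) (q : R[i])
    (ha : (1 <= a)%N) (haA : (a <= A)%N) (hr : (2 <= r)%N)
    (hq : `|q| < 1) :
  let lhs := fun p : overpartition => zmonom (q ^+ weight p) (mes r A a p) in
  let rhs := fun k : nat =>
    zmonom
      (q ^+ (A * 'C(k, 2) + k * a) / qpoch (- q ^+ a) (q ^+ A) k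
         * qpoch (- q ^+ ((r - 2) * a)) (q ^+ ((r - 2) * A)) k
       - q ^+ (A * 'C(k.+1, 2) + k.+1 * a) / qpoch (- q ^+ a) (q ^+ A) k.+1
         * qpoch (- q ^+ ((r - 2) * a)) (q ^+ ((r - 2) * A)) k.+1)
      (k * A + a)%N in
  [/\ zsummable lhs,
      zsummable rhs
    & zsum lhs = zscale (qpoch_infty (- q) q / qpoch_infty q q) (zsum rhs)].
Proof.
move=> lhs rhs; apply: zsum_eq_zscale => n.
have [[k ->]|n_out] := pselect (exists k, n = k * A + a)%N.
  exists (saturation_product A a r q k - saturation_product A a r q k.+1).
    apply: (has_sum_zmonom_inj (d := fun i => (i * A + a)%N)).
    exact: progression_inj.
  exact: has_gf_mes_eq.
exists 0.
  by apply: has_sum_zmonom_notin => k; apply/eqP => nE; apply: n_out; exists k.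
rewrite mulr0; apply: has_sum_zmonom_notin => p.
have [k ->] := mes_in_progression ha haA hr p.
by apply/eqP => nE; apply: n_out; exists k.
Qed.
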